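(* Let $E$ be an arbitrary (countable, not necessarily row-finite) directed graph and $K$ a field. Then $$\mathrm{Soc}(L_K(E))=I(P_l(E))=I(H),$$ where $P_l(E)$ is the set of line points of $E$, $H\subseteq E^0$ is the hereditary and saturated closure of $P_l(E)$, and for $X\subseteq E^0$, $I(X)$ denotes the two-sided ideal of $L_K(E)$ generated by $X$.
   Context: A graph $E=(E^0,E^1,r,s)$ consists of countable sets $E^0$ (vertices), $E^1$ (edges) and maps $r,s:E^1\to E^0$ (range, source). A vertex $v$ is a sink if $s^{-1}(v)=\emptyset$, an infinite emitter if $s^{-1}(v)$ is infinite, and regular if $s^{-1}(v)$ is finite and nonempty. A path is a vertex (length $0$) or a sequence $\mu=e_1\cdots e_n$ of edges with $r(e_i)=s(e_{i+1})$; $s(\mu)=s(e_1)$, $r(\mu)=r(e_n)$. A cycle is a path $e_1\cdots e_n$ ($n\ge1$) with $s(e_1)=r(e_n)$ and $s(e_i)\neq s(e_j)$ for $i\ne j$. The Leavitt path algebra $L_K(E)$ is the $K$-algebra generated by a set $\{v: v\in E^0\}$ of pairwise orthogonal idempotents and elements $\{e,e^*: e\in E^1\}$ subject to: (1) $s(e)e=er(e)=e$; (2) $r(e)e^*=e^*s(e)=e^*$; (3) $e^*e'=\delta_{e,e'}r(e)$; (4) $v=\sum_{s(e)=v}ee^*$ for every regular vertex $v$. Write $v\ge w$ if there is a path from $v$ to $w$ (length $0$ allowed), and $T(v)=\{w\in E^0: v\ge w\}$. A vertex $v$ is a bifurcation if $|s^{-1}(v)|\ge 2$. A vertex $u$ is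 a line point if there are neither bifurcations nor cycles at any vertex $w\in T(u)$; $P_l(E)$ is the set of line points. A set $H\subseteq E^0$ is hereditary if $v\in H$ and $v\geq w$ imply $w\in H$; it is saturated if every regular vertex $v$ with $r(s^{-1}(v))\subseteq H$ lies in $H$. The hereditary and saturated closure of $X\subseteq E^0$ is the smallest hereditary and saturated subset of $E^0$ containing $X$. $L_K(E)$ is semiprime; the socle $\mathrm{Soc}(R)$ of a semiprime ring $R$ is the sum of all its minimal left ideals (which equals the sum of all its minimal right ideals), and is $0$ if there are none. *)

(* Defs.v *)
From HB Require Import structures.
From mathcomp Require Import all_boot all_algebra.
From mathcomp Require Import finmap.
From mathcomp Require Import boolp classical_sets functions cardinality.

Set Implicit Arguments.
Unset Strict Implicit.
Unset Printing Implicit Defensive.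

Import GRing.Theory.
Local Open Scope classical_set_scope.
Local Open Scope quotient_scope.
Local Open Scope ring_scope.

(* Rings and algebras without unit: L_K(E) has no unit when E has infinitely
   many vertices, so GRing.PzRing and GRing.Algebra do not apply. *)

Declare Scope rng_scope.
Reserved Notation "x ** y" (at level 40, left associativity).

HB.mixin Record Zmodule_isRng R of GRing.Zmodule R := {
  rmul : R -> R -> R;
  rmulA : associative rmul;
  rmulDl : left_distributive rmul +%R;
  rmulDr : right_distributive rmul +%R
}.

#[short(type="rngType")]
HB.structure Definition Rng := {R of GRing.Zmodule R & Zmodule_isRng R}.

Notation "x ** y" := (rmul x y) : rng_scope.
Local Open Scope rng_scope.

HB.mixin Record LmodRng_isRngAlgebra (K : pzRingType) A
    of GRing.Lmodule K A & Rng A := {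
  rscaleAl : forall (k : K) (x y : A), k *: (x ** y) = (k *: x) ** y;
  rscaleAr : forall (k : K) (x y : A), k *: (x ** y) = x ** (k *: y)
}.

#[short(type="rngAlgType")]
HB.structure Definition RngAlgebra (K : pzRingType) :=
  {A of GRing.Lmodule K A & Rng A & LmodRng_isRngAlgebra K A}.

Section Ideals.
Variable R : rngType.
Implicit Types I J : set R.

Definition additive_subgroup I :=
  [/\ I 0, (forall x y, I x -> I y -> I (x + y)) & (forall x, I x -> I (- x))].

Definition left_ideal I :=
  additive_subgroup I /\ (forall a x, I x -> I (a ** x)).

Definition two_sided_ideal I :=
  [/\ additive_subgroup I, (forall a x, I x -> I (a ** x))
    & (forall a x, I x -> I (x ** a))].

Definition minimal_left_ideal I :=
  [/\ left_ideal I, I <> [set 0]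
    & forall J, left_ideal J -> J `<=` I -> J <> [set 0] -> J = I].

(* The sum of a family of subgroups is the subgroup generated by its union; the
   empty sum is [set 0]. *)
Definition socle : set R :=
  smallest additive_subgroup (\bigcup_(I in minimal_left_ideal) I).

Definition ideal_gen (X : set R) : set R := smallest two_sided_ideal X.

End Ideals.

Arguments socle R : clear implicits.

Record graph := Graph {
  vertex : countType;
  edge : countType;
  src : edge -> vertex;
  rge : edge -> vertex
}.

Section GraphTheory.
Variable E : graph.
Implicit Types (u v w : vertex E) (e f : edge E) (p : seq (edge E)).

Definition emits v : set (edge E) := [set e | src e = v].

Definition regular v := finite_set (emits v) /\ emits v !=set0.

(* The nonempty path e_1 ... e_n is given by its first edge e_1 and the sequence
   of the remaining ones. *)
Definition is_path e p := path (fun f g => rge f == src g) e p.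

Definition reaches v w :=
  v = w \/ exists e p, [/\ is_path e p, src e = v & rge (last e p) = w].

Definition tree v : set (vertex E) := [set w | reaches v w].

Definition is_cycle e p :=
  [/\ is_path e p, src e = rge (last e p) & uniq (map (@src E) (e :: p))].

Definition cycle_at v := exists e p, is_cycle e p /\ src e = v.

Definition bifurcation v := exists e f, [/\ emits v e, emits v f & e <> f].

Definition line_points : set (vertex E) :=
  [set u | forall w, tree u w -> ~ bifurcation w /\ ~ cycle_at w].

Definition hereditary (H : set (vertex E)) :=
  forall v w, H v -> reaches v w -> H w.

Definition saturated (H : set (vertex E)) :=
  forall v, regular v -> @rge E @` emits v `<=` H -> H v.

Definition hs_closure (X : set (vertex E)) : set (vertex E) :=
  smallest (fun H => hereditary H /\ saturated H) X.

End GraphTheory.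

Arguments line_points E : clear implicits.

Section LeavittPathAlgebra.
Variables (K : fieldType) (E : graph).

(* Formal expressions in the generators v, e and e^* (constructors Vtx, Edg and
   Gst). Their quotient by the least algebra congruence lpa_eq containing the
   defining relations is the algebra presented by these. *)
Inductive lpa_term : Type :=
| Vtx of vertex E
| Edg of edge E
| Gst of edge E
| Zero
| Add of lpa_term & lpa_term
| Opp of lpa_term
| Scale of K & lpa_term
| Mul of lpa_term & lpa_term.

Inductive lpa_eq : lpa_term -> lpa_term -> Prop :=
| lpa_refl x : lpa_eq x x
| lpa_sym x y : lpa_eq x y -> lpa_eq y x
| lpa_trans x y z : lpa_eq x y -> lpa_eq y z -> lpa_eq x z
| lpa_congD x x' y y' :
    lpa_eq x x' -> lpa_eq y y' -> lpa_eq (Add x y) (Add x' y')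
| lpa_congN x x' : lpa_eq x x' -> lpa_eq (Opp x) (Opp x')
| lpa_congZ k x x' : lpa_eq x x' -> lpa_eq (Scale k x) (Scale k x')
| lpa_congM x x' y y' :
    lpa_eq x x' -> lpa_eq y y' -> lpa_eq (Mul x y) (Mul x' y')
| lpa_addA x y z : lpa_eq (Add x (Add y z)) (Add (Add x y) z)
| lpa_addC x y : lpa_eq (Add x y) (Add y x)
| lpa_add0 x : lpa_eq (Add Zero x) x
| lpa_addN x : lpa_eq (Add (Opp x) x) Zero
| lpa_scaleA k l x : lpa_eq (Scale k (Scale l x)) (Scale (k * l) x)
| lpa_scale1 x : lpa_eq (Scale 1 x) x
| lpa_scaleDr k x y :
    lpa_eq (Scale k (Add x y)) (Add (Scale k x) (Scale k y))
| lpa_scaleDl k l x :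
    lpa_eq (Scale (k + l) x) (Add (Scale k x) (Scale l x))
| lpa_mulA x y z : lpa_eq (Mul x (Mul y z)) (Mul (Mul x y) z)
| lpa_mulDl x y z : lpa_eq (Mul (Add x y) z) (Add (Mul x z) (Mul y z))
| lpa_mulDr x y z : lpa_eq (Mul x (Add y z)) (Add (Mul x y) (Mul x z))
| lpa_scaleAl k x y : lpa_eq (Scale k (Mul x y)) (Mul (Scale k x) y)
| lpa_scaleAr k x y : lpa_eq (Scale k (Mul x y)) (Mul x (Scale k y))
| lpa_vtx u v : lpa_eq (Mul (Vtx u) (Vtx v)) (if u == v then Vtx u else Zero)
| lpa_src_edg e : lpa_eq (Mul (Vtx (src e)) (Edg e)) (Edg e)
| lpa_edg_rge e : lpa_eq (Mul (Edg e) (Vtx (rge e))) (Edg e)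
| lpa_rge_gst e : lpa_eq (Mul (Vtx (rge e)) (Gst e)) (Gst e)
| lpa_gst_src e : lpa_eq (Mul (Gst e) (Vtx (src e))) (Gst e)
| lpa_ck1 e f :
    lpa_eq (Mul (Gst e) (Edg f)) (if e == f then Vtx (rge e) else Zero)
| lpa_ck2 v : regular v ->
    lpa_eq (Vtx v)
           (\big[Add/Zero]_(e <- fset_set (emits v)) Mul (Edg e) (Gst e)).

HB.instance Definition _ := gen_eqMixin lpa_term.
HB.instance Definition _ := gen_choiceMixin lpa_term.

Definition lpa_eqb (x y : lpa_term) : bool := `[< lpa_eq x y >].

Lemma lpa_eqb_refl : reflexive lpa_eqb.
Proof. by move=> x; apply/asboolP; exact: lpa_refl. Qed.

Lemma lpa_eqb_sym : symmetric lpa_eqb.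
Proof.
by move=> x y; apply/asboolP/asboolP => h; exact: lpa_sym.
Qed.

Lemma lpa_eqb_trans : transitive lpa_eqb.
Proof.
move=> y x z /asboolP xy /asboolP yz; apply/asboolP; exact: lpa_trans xy yz.
Qed.

Canonical lpa_equiv := EquivRel lpa_eqb lpa_eqb_refl lpa_eqb_sym lpa_eqb_trans.

Definition LPA := {eq_quot lpa_equiv}.

HB.instance Definition _ := Choice.on LPA.

Definition lpa_class (x : lpa_term) : LPA := \pi_LPA x.

Lemma lpa_classP x y : lpa_class x = lpa_class y <-> lpa_eq x y.
Proof.
by split=> [/eqquotP /asboolP //|h]; apply/eqquotP/asboolP.
Qed.

Lemma lpa_class_repr (a : LPA) : lpa_class (repr a) = a.
Proof. exact: reprK. Qed.

Lemma lpa_ind (P : LPA -> Prop) : (forall x, P (lpa_class x)) -> forall a, P a.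
Proof. by move=> h a; rewrite -[a]lpa_class_repr. Qed.

Let repr_class x : lpa_eq (repr (lpa_class x)) x.
Proof. by apply/lpa_classP; rewrite lpa_class_repr. Qed.

Let lzero : LPA := lpa_class Zero.
Let ladd (a b : LPA) : LPA := lpa_class (Add (repr a) (repr b)).
Let lopp (a : LPA) : LPA := lpa_class (Opp (repr a)).
Let lscale (k : K) (a : LPA) : LPA := lpa_class (Scale k (repr a)).
Let lmul (a b : LPA) : LPA := lpa_class (Mul (repr a) (repr b)).

Let laddE x y : ladd (lpa_class x) (lpa_class y) = lpa_class (Add x y).
Proof. by apply/lpa_classP; apply: lpa_congD. Qed.

Let loppE x : lopp (lpa_class x) = lpa_class (Opp x).
Proof. by apply/lpa_classP; apply: lpa_congN. Qed.

Let lscaleE k x : lscale k (lpa_class x) = lpa_class (Scale k x).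
Proof. by apply/lpa_classP; apply: lpa_congZ. Qed.

Let lmulE x y : lmul (lpa_class x) (lpa_class y) = lpa_class (Mul x y).
Proof. by apply/lpa_classP; apply: lpa_congM. Qed.

Let opsE := (laddE, loppE, lscaleE, lmulE).

Let laddA : associative ladd.
Proof.
elim/lpa_ind=> x; elim/lpa_ind=> y; elim/lpa_ind=> z; rewrite !opsE.
by apply/lpa_classP; constructor.
Qed.

Let laddC : commutative ladd.
Proof.
elim/lpa_ind=> x; elim/lpa_ind=> y; rewrite !opsE.
by apply/lpa_classP; exact: lpa_addC.
Qed.

Let ladd0 : left_id lzero ladd.
Proof. by elim/lpa_ind=> x; rewrite !opsE; apply/lpa_classP; constructor. Qed.

Let laddN : left_inverse lzero lopp ladd.
Proof. by elim/lpa_ind=> x; rewrite !opsE; apply/lpa_classP; constructor. Qed.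

HB.instance Definition _ := GRing.isZmodule.Build LPA laddA laddC ladd0 laddN.

Let lscaleA k l (a : LPA) : lscale k (lscale l a) = lscale (k * l) a.
Proof.
by elim/lpa_ind: a => x; rewrite !opsE; apply/lpa_classP; constructor.
Qed.

Let lscale1 : left_id 1 lscale.
Proof. by elim/lpa_ind=> x; rewrite !opsE; apply/lpa_classP; constructor. Qed.

Let lscaleDr : right_distributive lscale +%R.
Proof.
move=> k; elim/lpa_ind=> x; elim/lpa_ind=> y.
by rewrite /GRing.add /= !opsE; apply/lpa_classP; constructor.
Qed.

Let lscaleDl (a : LPA) : {morph lscale^~ a : k l / k + l}.
Proof.
move=> k l; elim/lpa_ind: a => x.
by rewrite [in RHS]/GRing.add /= !opsE; apply/lpa_classP; constructor.
Qed.

HB.instance Definition _ :=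
  GRing.Zmodule_isLmodule.Build K LPA lscaleA lscale1 lscaleDr lscaleDl.

Let lmulA : associative lmul.
Proof.
elim/lpa_ind=> x; elim/lpa_ind=> y; elim/lpa_ind=> z; rewrite !opsE.
by apply/lpa_classP; constructor.
Qed.

Let lmulDl : left_distributive lmul +%R.
Proof.
elim/lpa_ind=> x; elim/lpa_ind=> y; elim/lpa_ind=> z.
by rewrite /GRing.add /= !opsE; apply/lpa_classP; constructor.
Qed.

Let lmulDr : right_distributive lmul +%R.
Proof.
elim/lpa_ind=> x; elim/lpa_ind=> y; elim/lpa_ind=> z.
by rewrite /GRing.add /= !opsE; apply/lpa_classP; constructor.
Qed.

HB.instance Definition _ := Zmodule_isRng.Build LPA lmulA lmulDl lmulDr.

Lemma lpa_class0 : lpa_class Zero = 0. Proof. by []. Qed.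

Lemma lpa_classD x y : lpa_class (Add x y) = lpa_class x + lpa_class y.
Proof. by rewrite -laddE. Qed.

Lemma lpa_classN x : lpa_class (Opp x) = - lpa_class x.
Proof. by rewrite -loppE. Qed.

Lemma lpa_classZ k x : lpa_class (Scale k x) = k *: lpa_class x.
Proof. by rewrite -lscaleE. Qed.

Lemma lpa_classM x y : lpa_class (Mul x y) = lpa_class x ** lpa_class y.
Proof. by rewrite -lmulE. Qed.

Let lrscaleAl k (a b : LPA) : k *: (a ** b) = (k *: a) ** b.
Proof.
elim/lpa_ind: a => x; elim/lpa_ind: b => y.
by rewrite -lpa_classM -!lpa_classZ -lpa_classM; apply/lpa_classP; constructor.
Qed.

Let lrscaleAr k (a b : LPA) : k *: (a ** b) = a ** (k *: b).
Proof.
elim/lpa_ind: a => x; elim/lpa_ind: b => y.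
by rewrite -lpa_classM -!lpa_classZ -lpa_classM; apply/lpa_classP; constructor.
Qed.

HB.instance Definition _ :=
  LmodRng_isRngAlgebra.Build K LPA lrscaleAl lrscaleAr.

Definition vtx (v : vertex E) : LPA := lpa_class (Vtx v).
Definition edg (e : edge E) : LPA := lpa_class (Edg e).
Definition gst (e : edge E) : LPA := lpa_class (Gst e).

(* The ideal I(X) of L_K(E). Since L_K(E) has local units, its ring ideals are
   K-subspaces, so this is also the algebra ideal generated by X. *)
Definition lpa_ideal (X : set (vertex E)) : set LPA := ideal_gen (vtx @` X).

End LeavittPathAlgebra.

Arguments lpa_ideal K {E} X.

(* A Leavitt E-family; L_K(E) carries the universal one. *)
Record leavitt_family (K : fieldType) (E : graph) (A : rngAlgType K)
    (fv : vertex E -> A) (fe fg : edge E -> A) : Prop := LeavittFamily {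
  lf_vtx : forall u v, fv u ** fv v = if u == v then fv u else 0;
  lf_src_edg : forall e, fv (src e) ** fe e = fe e;
  lf_edg_rge : forall e, fe e ** fv (rge e) = fe e;
  lf_rge_gst : forall e, fv (rge e) ** fg e = fg e;
  lf_gst_src : forall e, fg e ** fv (src e) = fg e;
  lf_ck1 : forall e f, fg e ** fe f = if e == f then fv (rge e) else 0;
  lf_ck2 : forall v, regular v ->
    fv v = \sum_(e <- fset_set (emits v)) fe e ** fg e
}.

Section UniversalProperty.
Variables (K : fieldType) (E : graph).

Lemma LPA_leavitt_family :
  leavitt_family (@vtx K E) (@edg K E) (@gst K E).
Proof.
split=> [u v|e|e|e|e|e f|v rv]; rewrite /vtx /edg /gst -?lpa_classM.
- by rewrite -lpa_class0 -fun_if; apply/lpa_classP; constructor.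
- by apply/lpa_classP; constructor.
- by apply/lpa_classP; constructor.
- by apply/lpa_classP; constructor.
- by apply/lpa_classP; constructor.
- by rewrite -lpa_class0 -fun_if; apply/lpa_classP; constructor.
have /lpa_classP -> := lpa_ck2 K rv.
rewrite (big_morph _ (@lpa_classD K E) (@lpa_class0 K E)).
by apply: eq_bigr => e _; rewrite lpa_classM.
Qed.

Variables (A : rngAlgType K) (fv : vertex E -> A) (fe fg : edge E -> A).

Fixpoint lpa_eval (x : lpa_term K E) : A :=
  match x with
  | Vtx v => fv v
  | Edg e => fe e
  | Gst e => fg e
  | Zero => 0
  | Add x y => lpa_eval x + lpa_eval y
  | Opp x => - lpa_eval x
  | Scale k x => k *: lpa_eval x
  | Mul x y => lpa_eval x ** lpa_eval y
  end.

Hypothesis fA : leavitt_family fv fe fg.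

Lemma lpa_evalP x y : lpa_eq x y -> lpa_eval x = lpa_eval y.
Proof.
elim=> {x y} /=.
- by [].
- by move=> x y _ ->.
- by move=> x y z _ -> _ ->.
- by move=> x x' y y' _ -> _ ->.
- by move=> x x' _ ->.
- by move=> k x x' _ ->.
- by move=> x x' y y' _ -> _ ->.
- by move=> x y z; rewrite addrA.
- by move=> x y; rewrite addrC.
- by move=> x; rewrite add0r.
- by move=> x; rewrite addNr.
- by move=> k l x; rewrite scalerA.
- by move=> x; rewrite scale1r.
- by move=> k x y; rewrite scalerDr.
- by move=> k l x; rewrite scalerDl.
- by move=> x y z; rewrite rmulA.
- by move=> x y z; rewrite rmulDl.
- by move=> x y z; rewrite rmulDr.
- by move=> k x y; rewrite rscaleAl.
- by move=> k x y; rewrite rscaleAr.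
- by move=> u v; rewrite (lf_vtx fA); case: ifP.
- exact: lf_src_edg fA.
- exact: lf_edg_rge fA.
- exact: lf_rge_gst fA.
- exact: lf_gst_src fA.
- by move=> e f; rewrite (lf_ck1 fA); case: ifP.
move=> v rv; rewrite (lf_ck2 fA rv).
by apply: (big_ind2 (fun a x => a = lpa_eval x)) => //= a x b y -> ->.
Qed.

Lemma LPA_universal : exists! phi : LPA K E -> A,
  [/\ (forall a b, phi (a + b) = phi a + phi b),
      (forall k a, phi (k *: a) = k *: phi a),
      (forall a b, phi (a ** b) = phi a ** phi b)
    & [/\ (forall v, phi (vtx K v) = fv v), (forall e, phi (edg K e) = fe e)
        & (forall e, phi (gst K e) = fg e)]].
Proof.
pose phi (a : LPA K E) := lpa_eval (repr a).
have phiE x : phi (lpa_class x) = lpa_eval x.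
  by apply: lpa_evalP; apply/lpa_classP; rewrite lpa_class_repr.
exists phi; split.
  split.
  - by elim/lpa_ind=> x; elim/lpa_ind=> y; rewrite -lpa_classD !phiE.
  - by move=> k; elim/lpa_ind=> x; rewrite -lpa_classZ !phiE.
  - by elim/lpa_ind=> x; elim/lpa_ind=> y; rewrite -lpa_classM !phiE.
  - by split=> ?; rewrite phiE.
move=> psi [psiD psiZ psiM [psiv psie psig]].
have psi0 : psi 0 = 0 by rewrite -(scale0r 0) psiZ scale0r.
apply/funext; elim/lpa_ind=> x; rewrite phiE; elim: x => /=.
- by move=> v; rewrite -psiv.
- by move=> e; rewrite -psie.
- by move=> e; rewrite -psig.
- by rewrite lpa_class0.
- by move=> x hx y hy; rewrite lpa_classD psiD hx hy.
- by move=> x hx; rewrite lpa_classN -[- lpa_class x]scaleN1r psiZ scaleN1r hx.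
- by move=> k x hx; rewrite lpa_classZ psiZ hx.
- by move=> x hx y hy; rewrite lpa_classM psiM hx hy.
Qed.

End UniversalProperty.

(* Main.v *)
Require Import Defs.
From mathcomp Require Import all_boot all_algebra.
From mathcomp Require Import finmap.
From mathcomp Require Import boolp classical_sets functions cardinality.

(* A left ideal L u generated by a line point u is minimal: if x = x u is nonzero,
   right multiplication by a suitable path q turns x into a combination of
   distinct paths ending at a line point w; since no closed path passes through w,
   the ghost of a shortest of these paths sends x q to a nonzero multiple of w,
   and q q^* = u because nothing branches along q.

   Conversely, every nonzero a satisfies l a r = k w + (a combination of closed
   paths at w), with k nonzero, where either there are no closed paths or T(w)
   has no bifurcation. If a lies in a minimal left ideal, then so does l a, which
   can be recovered from each nonzero b l a. In the presence of a closed path t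
   this fails for b = w - t, as one sees in a graded version of the representation
   of L_K(E) on boundary paths, where t acts as a power of an indeterminate z.
   Hence l a r = k w, from which w is a line point and the minimal left ideal is
   contained in the ideal generated by w. *)

Set Implicit Arguments.
Unset Strict Implicit.
Unset Printing Implicit Defensive.

Import GRing.Theory.
Local Open Scope classical_set_scope.
Local Open Scope quotient_scope.
Local Open Scope ring_scope.
Local Open Scope rng_scope.

(** * Arithmetic in rings without unit *)

Section RngTheory.
Variable R : rngType.
Implicit Types (x y z : R) (I J : set R).

Lemma rmul0r x : 0 ** x = 0.
Proof. by apply: (addIr (0 ** x)); rewrite -rmulDl !add0r. Qed.

Lemma rmulr0 x : x ** 0 = 0.
Proof. by apply: (addIr (x ** 0)); rewrite -rmulDr !add0r. Qed.

Lemma rmulNr x y : (- x) ** y = - (x ** y).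
Proof. by apply: (addIr (x ** y)); rewrite -rmulDl !addNr rmul0r. Qed.

Lemma rmulrN x y : x ** (- y) = - (x ** y).
Proof. by apply: (addIr (x ** y)); rewrite -rmulDr !addNr rmulr0. Qed.

Lemma rmulBl x y z : (x - y) ** z = x ** z - y ** z.
Proof. by rewrite rmulDl rmulNr. Qed.

Lemma rmulBr x y z : x ** (y - z) = x ** y - x ** z.
Proof. by rewrite rmulDr rmulrN. Qed.

Lemma rmul_suml (T : Type) (s : seq T) (P : pred T) (F : T -> R) x :
  (\sum_(i <- s | P i) F i) ** x = \sum_(i <- s | P i) F i ** x.
Proof. by apply: (big_morph (fun y => y ** x)) => [y z|]; rewrite ?rmulDl ?rmul0r. Qed.

Lemma rmul_sumr (T : Type) (s : seq T) (P : pred T) (F : T -> R) x :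
  x ** (\sum_(i <- s | P i) F i) = \sum_(i <- s | P i) x ** F i.
Proof. by apply: (big_morph (rmul x)) => [y z|]; rewrite ?rmulDr ?rmulr0. Qed.

End RngTheory.

(** * Paths with prescribed endpoints *)

Section Walks.
Variable E : graph.
Implicit Types (u v w : vertex E) (e f : edge E) (p q t : seq (edge E)).

Lemma emits1 e : ~ bifurcation (src e) -> emits (src e) = [set e].
Proof.
move=> nb; apply/seteqP; split=> f /=; last by move=> ->.
by move=> fe; apply: contrapT => nfe; apply: nb; exists f, e.
Qed.

Lemma regular1 e : ~ bifurcation (src e) -> regular (src e).
Proof. by move=> /emits1 eE; rewrite /regular eE; split=> //; exists e. Qed.

(** Carrying both endpoints lets the empty list be the path of length 0 at any vertex, so paths are
    joined and split without case distinctions. *)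
Fixpoint walk u p v : bool :=
  if p is e :: p' then (src e == u) && walk (rge e) p' v else u == v.

Lemma walk_cat u v w p q : walk u p v -> walk v q w -> walk u (p ++ q) w.
Proof. by elim: p u => [u /= /eqP ->|e p ih u /= /andP[-> /ih]]. Qed.

Lemma walk_catE u w p q : walk u (p ++ q) w ->
  exists2 v, walk u p v & walk v q w.
Proof.
elim: p u => [|e p ih] u /=; first by exists u.
by move=> /andP[-> /ih].
Qed.

Lemma walk1 e : walk (src e) [:: e] (rge e).
Proof. by rewrite /= !eqxx. Qed.

Lemma path_walk e p : is_path e p -> walk (src e) (e :: p) (rge (last e p)).
Proof.
elim: p e => [|f p ih] e /=; first by rewrite !eqxx.
by move=> /andP[/eqP -> /ih /= /andP[_ ->]]; rewrite !eqxx.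
Qed.

Lemma walk_path u e p w : walk u (e :: p) w ->
  [/\ is_path e p, src e = u & rge (last e p) = w].
Proof.
elim: p u e => [|f p ih] u e; first by move=> /andP[/eqP -> /eqP].
by move=> /andP[/eqP eu /ih[pp fu <-]]; split; rewrite // /is_path /= fu eqxx.
Qed.

Lemma reachesP u w : reaches u w <-> exists p, walk u p w.
Proof.
split=> [[->|[e [p [pp <- <-]]]]|[[/eqP ->|e p /walk_path[pp eu pw]]]].
- by exists [::] => /=.
- by exists (e :: p); exact: path_walk.
- by left.
by right; exists e, p.
Qed.

Lemma reaches_trans v u w : reaches u v -> reaches v w -> reaches u w.
Proof.
move=> /reachesP[p up] /reachesP[q vq]; apply/reachesP.
by exists (p ++ q); exact: walk_cat up vq.
Qed.

Lemma cycle_walk w : cycle_at w -> exists e p, walk w (e :: p) w.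
Proof.
move=> [e [p [[pp se _] <-]]]; exists e, p.
by rewrite {2}se; exact: path_walk.
Qed.

(* A shortest closed path among those at vertices of the tree is a cycle. *)
Lemma line_point_no_closed_walk u w e p :
  line_points E u -> reaches u w -> ~ walk w (e :: p) w.
Proof.
move=> lu; have [n] := ubnP (size p).
elim: n w e p => // n ih w e p; rewrite ltnS => pn uw wp.
have [_ []] := lu _ uw; have [pp ew ws] := walk_path wp.
exists e, p; split=> //; split=> //; first by rewrite ew ws.
apply: contrapT => /negP /(uniqPn w)[i [j [ij]]].
rewrite size_map => jp eij.
(* The sources at positions [i < j] agree, so the segment [d] between them is a nonempty closed path
   with fewer edges than [s]. *)
pose s := e :: p; pose d := take (j - i) (drop i s).
have sE : s = take i s ++ (d ++ drop j s).
  by rewrite -{1}(cat_take_drop i s) -{1}(cat_take_drop (j - i) (drop i s))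
     drop_drop subnK // ltnW.
have dsz : size d = (j - i)%N.
  by rewrite size_take size_drop; case: ifP => //; rewrite ltn_sub2r //
     ?(ltn_trans ij) // jp.
have [v wv] : exists2 v, walk w (take i s) v & walk v (d ++ drop j s) w.
  by apply: walk_catE; rewrite -sE.
move=> vw; have [v' vd v'w] := walk_catE vw.
have vi : src (nth e s i) = v.
  move: vw; have : drop i s = d ++ drop j s.
    by rewrite /d -[in drop j s](subnK (ltnW ij)) -drop_drop cat_take_drop.
  by rewrite (drop_nth e) ?(ltn_trans ij) // => <- /= /andP[/eqP].
have vj : src (nth e s j) = v'.
  by move: v'w; rewrite (drop_nth e) //= => /andP[/eqP].
move: eij; rewrite !(nth_map e) // ?(ltn_trans ij) // vi vj => vv'.
case: d dsz vd vw sE => [|f d] /= dsz; first by have := subn_gt0 i j; rewrite -dsz ij.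
rewrite -vv' => vd _ _; apply: (ih v f d) => //.
  by apply: leq_trans pn; rewrite dsz (leq_trans (leq_subr _ _)).
by apply: reaches_trans uw _; apply/reachesP; exists (take i s).
Qed.

End Walks.

(** * The graded representation on functions of boundary paths *)

Section BoundaryRepresentation.
Variables (K : fieldType) (E : graph).
Let F := {fraction {poly K}}.
(** Passing to fractions makes [z] invertible, as ghosts require; values that are polynomials can
    still be evaluated. *)
Let z : F := tofrac 'X.

(* [y n] is the [n]-th vertex of the path with the edge taken there; the entries
   after the first [None] are irrelevant. *)
Let X := nat -> vertex E * option (edge E).
Implicit Types (y : X) (phi psi : X -> F).

(** A path may stop only at a sink or an infinite emitter; at a regular vertex it must go on, as
    relation (4) demands. *)
Definition boundary_path (y : nat -> vertex E * option (edge E)) :=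
  forall n, match (y n).2 with
  | Some e => src e = (y n).1 /\ (y n.+1).1 = rge e
  | None => ~ regular (y n).1
  end.

Let shift y : X := fun n => y n.+1.
Let prepend e y : X := fun n => if n is m.+1 then y m else (src e, Some e).

Fixpoint act (x : lpa_term K E) (phi : (nat -> vertex E * option (edge E)) -> F)
    (y : nat -> vertex E * option (edge E)) : F :=
  match x with
  | Vtx v => if `[< boundary_path y >] && ((y 0).1 == v) then phi y else 0
  | Edg e => if `[< boundary_path y >] && ((y 0).2 == Some e)
             then z * phi (shift y) else 0
  | Gst e => if `[< boundary_path y >] && ((y 0).1 == rge e)
             then z^-1 * phi (prepend e y) else 0
  | Zero => 0
  | Add a b => act a phi y + act b phi y
  | Opp a => - act a phi y
  | Scale k a => tofrac k%:P * act a phi y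
  | Mul a b => act a (act b phi) y
  end.

Lemma z_neq0 : z != 0.
Proof. by rewrite tofrac_eq0 polyX_eq0. Qed.

Lemma act_linear x c phi psi :
  act x (fun y => c * phi y + psi y) = (fun y => c * act x phi y + act x psi y).
Proof.
elim: x phi psi => [v|e|e||a ha b hb|a ha|k a ha|a ha b hb] phi psi;
  apply/funext => y /=; try case: ifP => _; rewrite ?mulr0 ?addr0 ?ha ?hb //.
- by rewrite mulrDr mulrCA.
- by rewrite mulrDr mulrCA.
- by rewrite mulrDr addrACA.
- by rewrite mulrN opprD.
- by rewrite mulrDr mulrCA.
- by rewrite ha.
Qed.

Lemma act0 x : act x (fun=> 0) = fun=> 0.
Proof.
have h := act_linear x 0 (fun=> 0) (fun=> 0).
(* With [c = -1], linearity expresses the image of the zero function as its own negative plus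
   itself. *)
have := act_linear x (- 1) (fun=> 0) (fun=> 0).
under [in act _ _]eq_fun do rewrite mulr0 addr0.
by move=> ->; apply/funext=> y; rewrite mulN1r addNr.
Qed.

Lemma actZ x c phi : act x (fun y => c * phi y) = fun y => c * act x phi y.
Proof.
have := act_linear x c phi (fun=> 0); rewrite act0.
under [in act _ _]eq_fun do rewrite addr0.
by move=> ->; apply/funext=> y; rewrite addr0.
Qed.

Lemma actD x phi psi :
  act x (fun y => phi y + psi y) = fun y => act x phi y + act x psi y.
Proof.
have := act_linear x 1 phi psi.
under [in act _ _]eq_fun do rewrite mul1r.
by move=> ->; apply/funext=> y; rewrite mul1r.
Qed.

Lemma boundary_shift y : boundary_path y -> boundary_path (shift y).
Proof. by move=> h n; exact: h. Qed.

Lemma boundary_prepend e y :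
  boundary_path y -> (y 0).1 = rge e -> boundary_path (prepend e y).
Proof. by move=> h h0 [|n] //=; exact: h. Qed.

Lemma prepend_shift e y :
  boundary_path y -> (y 0).2 = Some e -> prepend e (shift y) = y.
Proof.
move=> h h0; apply/funext => -[|n] //=; have := h 0; rewrite h0 => -[-> _].
by rewrite -h0; case: (y 0).
Qed.

Lemma boundary_edge y e : boundary_path y -> (y 0).2 = Some e ->
  (y 0).1 = src e /\ (shift y 0).1 = rge e.
Proof. by move=> h h0; have := h 0; rewrite h0 => -[-> ->]. Qed.

Lemma act_eq a b : lpa_eq a b -> act a = act b.
Proof.
elim=> {a b} /=.
- by [].
- by move=> a b _ ->.
- by move=> a b c _ -> _ ->.
- by move=> a a' b b' _ -> _ ->.
- by move=> a a' _ ->.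
- by move=> k a a' _ ->.
- by move=> a a' b b' _ -> _ ->.
- by move=> a b c; apply/funext=> phi; apply/funext=> y; rewrite addrA.
- by move=> a b; apply/funext=> phi; apply/funext=> y; rewrite addrC.
- by move=> a; apply/funext=> phi; apply/funext=> y; rewrite add0r.
- by move=> a; apply/funext=> phi; apply/funext=> y; rewrite addNr.
- move=> k l a; apply/funext=> phi; apply/funext=> y.
  by rewrite mulrA polyCM tofracM.
- by move=> a; apply/funext=> phi; apply/funext=> y; rewrite polyC1 tofrac1 mul1r.
- by move=> k a b; apply/funext=> phi; apply/funext=> y; rewrite mulrDr.
- move=> k l a; apply/funext=> phi; apply/funext=> y.
  by rewrite polyCD tofracD mulrDl.
- by [].
- by [].
- by move=> a b c; apply/funext=> phi; rewrite actD.
- by [].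
- by move=> k a b; apply/funext=> phi; rewrite actZ.
- move=> u v; apply/funext=> phi; apply/funext=> y /=.
  case: (eqVneq u v) => [->|uv] /=; first by case: ifP => // ->.
  by case: ifP => // /andP[_ /eqP ->]; rewrite (negPf uv) andbF.
- move=> e; apply/funext=> phi; apply/funext=> y /=.
  case: (asboolP (boundary_path y)) => [yP|] //=.
  case: eqP => // nye; case: eqP => // y0.
  by case: (boundary_edge yP y0).
- move=> e; apply/funext=> phi; apply/funext=> y /=.
  case: (asboolP (boundary_path y)) => [yP|] //=.
  case: eqP => // ye; case: (boundary_edge yP ye) => _ ->.
  by rewrite eqxx andbT asboolT //; exact: boundary_shift.
- by move=> e; apply/funext=> phi; apply/funext=> y /=; case: ifP => // ->.
- move=> e; apply/funext=> phi; apply/funext=> y /=.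
  case: (asboolP (boundary_path y)) => [yP|] //=.
  by case: eqP => // ye; rewrite eqxx andbT asboolT //; exact: boundary_prepend.
- move=> e f; apply/funext=> phi; apply/funext=> y /=.
  have -> : act (if e == f then Vtx K (rge e) else Zero K E) phi y =
    if [&& e == f, `[< boundary_path y >] & (y 0).1 == rge e] then phi y else 0.
    by case: eqP.
  case: (asboolP (boundary_path y)) => [yP|] /=; last by rewrite andbF.
  case: eqP => [ye|_]; last by rewrite andbF.
  rewrite asboolT /=; last exact: boundary_prepend.
  have -> : (Some e == Some f) = (e == f) by [].
  by case: eqP => //= _; rewrite ?mulr0 ?mulKf // z_neq0.
move=> v vr; apply/funext=> phi; apply/funext=> y /=.
have finv := proj1 vr.
transitivity (\sum_(e <- fset_set (emits v)) act (Mul (Edg K e) (Gst K e)) phi y);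
  last first.
  by apply: (big_ind2 (fun a x => a = act x phi y)) => //= a x b w -> ->.
case: (asboolP (boundary_path y)) => [yP|nyP] /=; last first.
  by rewrite big1 // => e _; rewrite asboolF.
(* The summand [e e^*] restricts [phi] to the boundary paths that begin with [e]. *)
have e1 e : (if true && ((y 0).2 == Some e) then z *
    (if `[< boundary_path (shift y) >] && ((shift y 0).1 == rge e)
     then z^-1 * phi (prepend e (shift y)) else 0) else 0) =
   if (y 0).2 == Some e then phi y else 0.
  rewrite /=; case: eqP => // ye; have [_ ->] := boundary_edge yP ye.
  rewrite eqxx andbT asboolT /= ?prepend_shift //; last exact: boundary_shift.
  by rewrite mulVKf // z_neq0.
rewrite asboolT //; under eq_bigr => e _ do rewrite e1.
case: eqP => [yv|nyv].
  (* Since [v] is regular, [y] takes an edge there, and exactly the summand of that edge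
     survives. *)
  have := yP 0; rewrite yv; case y0: (y 0).2 => [e|] //=; rewrite ?y0 // => -[ev _].
  have ein : e \in fset_set (emits v) by rewrite in_fset_set // inE.
  rewrite (bigD1_seq e ein (fset_uniq _)) /= eqxx.
  by rewrite big1 ?addr0 // => f fe; case: eqP => // -[/eqP]; rewrite eq_sym (negPf fe).
rewrite big_seq big1 // => e; rewrite in_fset_set // inE /emits /= => ev.
by case: eqP => // /(boundary_edge yP)[]; rewrite ev.
Qed.

Let poly_valued phi := forall y, exists p : {poly K}, phi y = tofrac p.

(** Denominators come only from the ghosts in [x]. Since [N] does not depend on [phi], the exponents
    add up in a product. *)
Lemma act_poly_valued x : exists N, forall phi,
  poly_valued phi -> poly_valued (fun y => z ^+ N * act x phi y).
Proof.
have F0 : exists p : {poly K}, 0 = tofrac p by exists 0; rewrite tofrac0.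
elim: x => [v|e|e||a [N ha] b [M hb]|a [N ha]|k a [N ha]|a [N ha] b [M hb]].
- by exists 0 => phi h y /=; rewrite mul1r; case: ifP.
- exists 0 => phi h y /=; rewrite mul1r; case: ifP => // _.
  by have [p ->] := h (shift y); exists ('X * p); rewrite tofracM.
- exists 1 => phi h y /=; case: ifP => _; last by rewrite mulr0.
  by rewrite mulVKf ?z_neq0.
- by exists 0 => phi h y /=; rewrite mulr0.
- exists (N + M)%N => phi h y /=; rewrite mulrDr.
  have [p hp] := ha _ h y; have [q hq] := hb _ h y.
  exists ('X^M * p + 'X^N * q).
  by rewrite tofracD !tofracM -hp -hq !tofracXn !mulrA -!exprD [(M + N)%N]addnC.
- exists N => phi h y /=; have [p hp] := ha _ h y.
  by exists (- p); rewrite mulrN hp tofracN.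
- exists N => phi h y /=; have [p hp] := ha _ h y.
  by exists (k%:P * p); rewrite mulrCA hp tofracM.
exists (N + M)%N => phi h y /=; have [p hp] := ha _ (hb _ h) y.
by exists p; rewrite -hp actZ mulrA -exprD.
Qed.

Lemma boundary_path_from v : exists2 y, boundary_path y & (y 0).1 = v.
Proof.
have h u : exists o : option (edge E),
    if o is Some e then src e = u else ~ regular u.
  have [[_ [e eu]]|nr] := pselect (regular u); first by exists (Some e).
  by exists None.
have [s sP] := boolp.choice h.
(* Where [s] selects no edge the sequence stays put, so [boundary_path] also holds for all later
   entries. *)
pose next u := if s u is Some e then rge e else u.
exists (fun n => (iter n next v, s (iter n next v))) => // n /=.
by move: (sP (iter n next v)); rewrite /next; case: (s _).
Qed.

Definition indicator w (y : nat -> vertex E * option (edge E)) : F :=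
  if `[< boundary_path y >] && ((y 0).1 == w) then 1 else 0.

Definition lact (a : LPA K E) := act (repr a).

Lemma lact_class x : lact (lpa_class x) = act x.
Proof. by apply: act_eq; apply/lpa_classP; rewrite lpa_class_repr. Qed.

Lemma lactM a b phi : lact (a ** b) phi = lact a (lact b phi).
Proof.
by elim/lpa_ind: a => a; elim/lpa_ind: b => b; rewrite -lpa_classM !lact_class.
Qed.

Lemma lactD a b phi y : lact (a + b) phi y = lact a phi y + lact b phi y.
Proof.
by elim/lpa_ind: a => a; elim/lpa_ind: b => b; rewrite -lpa_classD !lact_class.
Qed.

Lemma lactN a phi y : lact (- a) phi y = - lact a phi y.
Proof. by elim/lpa_ind: a => a; rewrite -lpa_classN !lact_class. Qed.

Lemma lactZ k a phi y : lact (k *: a) phi y = tofrac k%:P * lact a phi y.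
Proof. by elim/lpa_ind: a => a; rewrite -lpa_classZ !lact_class. Qed.

Lemma lact0 phi y : lact 0 phi y = 0.
Proof. by rewrite -lpa_class0 lact_class. Qed.

Lemma lact_scale a c phi : lact a (fun y => c * phi y) = fun y => c * lact a phi y.
Proof. exact: actZ. Qed.

Lemma lact_vtx_indicator w : lact (vtx K w) (indicator w) = indicator w.
Proof.
by rewrite lact_class; apply/funext=> y /=; rewrite /indicator; case: ifP => // ->.
Qed.

(** The vertex [src e] is regular with [e] as its only edge, so every boundary path from it begins
    with [e]. *)
Lemma lact_edg_indicator e : ~ bifurcation (src e) ->
  lact (edg K e) (indicator (rge e)) = fun y => z * indicator (src e) y.
Proof.
move=> nb; rewrite lact_class; apply/funext=> y /=; rewrite /indicator.
case: (asboolP (boundary_path y)) => [yP|_] /=; last by rewrite mulr0.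
have emE := emits1 nb; have rege := regular1 nb.
case: eqP => [ye|nye].
  have [-> ->] := boundary_edge yP ye.
  by rewrite !eqxx andbT asboolT //; exact: boundary_shift.
case: eqP => [yv|]; last by rewrite mulr0.
have := yP 0; rewrite yv; case y0: (y 0).2 => [f|] // -[fe _].
have : emits (src e) f by [].
by rewrite emE /= => fE; case: nye; rewrite y0 fE.
Qed.

Lemma indicator_neq0 (w : vertex E) : exists y, indicator w y = 1.
Proof.
have [y yP yw] := boundary_path_from w; exists y.
by rewrite /indicator asboolT // yw eqxx.
Qed.

Lemma vtx_neq0 (v : vertex E) : vtx K v != 0.
Proof.
apply/eqP=> v0; have [y yv] := indicator_neq0 v.
have /(congr1 (fun f => f y)) := lact_vtx_indicator v.
by rewrite v0 lact0 yv => /esym/eqP; rewrite oner_eq0.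
Qed.

(* Up to a power of [z], [a] acts on polynomials, where [1 - z ^ d] is not
   invertible since it vanishes at [z = 1]. *)
Lemma lact_not_inverse a w d : (0 < d)%N ->
  (forall y, (1 - z ^+ d) * lact a (indicator w) y = indicator w y) -> False.
Proof.
move=> d0 h; have [N hN] := act_poly_valued (repr a).
have iP : poly_valued (indicator w).
  move=> y; rewrite /indicator; case: ifP => _; first by exists 1; rewrite tofrac1.
  by exists 0; rewrite tofrac0.
have [y yw] := indicator_neq0 w; have [p hp] := hN _ iP y.
have /eqP : tofrac ('X^N : {poly K}) = tofrac ((1 - 'X^d) * p).
  rewrite tofracM -hp tofracB tofrac1 !tofracXn mulrCA.
  by have := h y; rewrite yw => ->; rewrite mulr1.
rewrite tofrac_eq => /eqP/(congr1 (fun q => q.[1])).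
by rewrite !hornerE !expr1n subrr mul0r => /eqP; rewrite oner_eq0.
Qed.

End BoundaryRepresentation.

(** * Real paths, ghost paths and local units *)

Section Monomials.
Variables (K : fieldType) (E : graph).
Local Notation L := (LPA K E).
Local Notation vtx := (@vtx K E).
Local Notation edg := (@edg K E).
Local Notation gst := (@gst K E).
Implicit Types (u v w : vertex E) (e f : edge E) (p q t : seq (edge E)).
Implicit Types (a b x y : L).

Let fam := LPA_leavitt_family K E.

Lemma vtxM u v : vtx u ** vtx v = if u == v then vtx u else 0.
Proof. exact: lf_vtx fam u v. Qed.
Lemma vtxMid v : vtx v ** vtx v = vtx v.
Proof. by rewrite vtxM eqxx. Qed.
Lemma src_edg e : vtx (src e) ** edg e = edg e.
Proof. exact: lf_src_edg fam e. Qed.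
Lemma edg_rge e : edg e ** vtx (rge e) = edg e.
Proof. exact: lf_edg_rge fam e. Qed.
Lemma rge_gst e : vtx (rge e) ** gst e = gst e.
Proof. exact: lf_rge_gst fam e. Qed.
Lemma gst_src e : gst e ** vtx (src e) = gst e.
Proof. exact: lf_gst_src fam e. Qed.
Lemma gst_edg e f : gst e ** edg f = if e == f then vtx (rge e) else 0.
Proof. exact: lf_ck1 fam e f. Qed.
Lemma gst_edgK e : gst e ** edg e = vtx (rge e).
Proof. by rewrite gst_edg eqxx. Qed.

(** The vertex [v] is meant to be the range of [p], which an empty [p] does not determine;
    [gmon p v] is then the ghost path [p^*]. *)
Definition mon p v : L := foldr (fun e x => edg e ** x) (vtx v) p.
Definition gmon p v : L := foldr (fun e x => x ** gst e) (vtx v) p.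

Lemma mon_vtx p v : mon p v ** vtx v = mon p v.
Proof. by elim: p => [|e p ih] /=; rewrite ?vtxMid // -rmulA ih. Qed.

Lemma vtx_gmon p v : vtx v ** gmon p v = gmon p v.
Proof. by elim: p => [|e p ih] /=; rewrite ?vtxMid // rmulA ih. Qed.

Lemma vtx_mon u p v : walk u p v -> vtx u ** mon p v = mon p v.
Proof.
case: p => [/eqP ->|e p /andP[/eqP <- _]] /=; first exact: vtxMid.
by rewrite rmulA src_edg.
Qed.

Lemma gmon_vtx u p v : walk u p v -> gmon p v ** vtx u = gmon p v.
Proof.
case: p => [/eqP ->|e p /andP[/eqP <- _]] /=; first exact: vtxMid.
by rewrite -rmulA gst_src.
Qed.

Lemma mon_cat v p q w : walk v q w -> mon p v ** mon q w = mon (p ++ q) w.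
Proof.
by move=> vq; elim: p => [|e p ih] /=; rewrite ?vtx_mon // -rmulA ih.
Qed.

Lemma gmon_mon_cat u v w p q : walk u p v -> walk v q w ->
  gmon p v ** mon (p ++ q) w = mon q w.
Proof.
move=> up vq; elim: p u up => [|e p ih] u /=; first by rewrite vtx_mon.
move=> /andP[_ pv]; rewrite -rmulA [gst e ** _]rmulA gst_edgK.
by rewrite vtx_mon ?(ih _ pv) //; exact: walk_cat pv vq.
Qed.

Lemma gmonK u p v : walk u p v -> gmon p v ** mon p v = vtx v.
Proof.
by move=> up; rewrite -{2}[p]cats0 (gmon_mon_cat up) //=.
Qed.

Definition vsum (s : seq (vertex E)) : L := \sum_(v <- s) vtx v.

Lemma vsum_vtx s v : uniq s -> v \in s -> vsum s ** vtx v = vtx v.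
Proof.
move=> us vs; rewrite /vsum rmul_suml (bigD1_seq v) //= vtxMid.
by rewrite big1 ?addr0 // => u /negPf uv; rewrite vtxM uv.
Qed.

Lemma vtx_vsum s v : uniq s -> v \in s -> vtx v ** vsum s = vtx v.
Proof.
move=> us vs; rewrite /vsum rmul_sumr (bigD1_seq v) //= vtxMid.
by rewrite big1 ?addr0 // => u /negPf uv; rewrite vtxM eq_sym uv.
Qed.

(** Admitting every larger list lets the induction merge the lists of two subterms; duplicates are
    excluded because [vsum] would count them twice. *)
Lemma local_units a : exists s : seq (vertex E), forall s', uniq s' -> {subset s <= s'} ->
  vsum s' ** a = a /\ a ** vsum s' = a.
Proof.
elim/lpa_ind: a; elim=> [v|e|e||x [s hs] y [t ht]|x [s hs]|k x [s hs]|x [s hs] y [t ht]].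
- exists [:: v] => s us sv; have vs : v \in s by apply: sv; rewrite inE.
  by rewrite vsum_vtx ?vtx_vsum.
- exists [:: src e; rge e] => s us sv; rewrite -/(edg e).
  have [es er] : src e \in s /\ rge e \in s by split; apply: sv; rewrite !inE eqxx ?orbT.
  split; first by rewrite -src_edg rmulA vsum_vtx.
  by rewrite -edg_rge -rmulA vtx_vsum.
- exists [:: src e; rge e] => s us sv; rewrite -/(gst e).
  have [es er] : src e \in s /\ rge e \in s by split; apply: sv; rewrite !inE eqxx ?orbT.
  split; first by rewrite -rge_gst rmulA vsum_vtx.
  by rewrite -gst_src -rmulA vtx_vsum.
- by exists [::] => s _ _; rewrite lpa_class0 rmul0r rmulr0.
- exists (s ++ t) => r ur h.
  have [|h1 h2] := hs r ur; first by move=> i hi; apply: h; rewrite mem_cat hi.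
  have [|h3 h4] := ht r ur; first by move=> i hi; apply: h; rewrite mem_cat hi orbT.
  by rewrite lpa_classD rmulDl rmulDr h1 h2 h3 h4.
- exists s => r ur h; have [h1 h2] := hs r ur h.
  by rewrite lpa_classN rmulNr rmulrN h1 h2.
- exists s => r ur h; have [h1 h2] := hs r ur h.
  by rewrite lpa_classZ -rscaleAl -rscaleAr h1 h2.
exists (s ++ t) => r ur h.
have [|h1 h2] := hs r ur; first by move=> i hi; apply: h; rewrite mem_cat hi.
have [|h3 h4] := ht r ur; first by move=> i hi; apply: h; rewrite mem_cat hi orbT.
by rewrite lpa_classM rmulA h1 -rmulA h4.
Qed.

Lemma left_unit a : exists y, y ** a = a.
Proof.
have [s hs] := local_units a; exists (vsum (undup s)).
by have [|//] := hs _ (undup_uniq s); move=> i; rewrite mem_undup.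
Qed.

Lemma exists_vtx_neq0 a : a != 0 -> exists v, a ** vtx v != 0.
Proof.
move=> a0; have [s hs] := local_units a; apply: contrapT => nv.
have [|_] := hs _ (undup_uniq s); first by move=> i; rewrite mem_undup.
rewrite rmul_sumr big1 => [/esym/eqP|v _]; first by rewrite (negPf a0).
by apply: contrapT => /eqP av; apply: nv; exists v.
Qed.

End Monomials.

(** * Removing ghosts by right multiplication with a path *)

Section Reduction.
Variables (K : fieldType) (E : graph).
Local Notation L := (LPA K E).
Local Notation vtx := (@vtx K E).
Local Notation edg := (@edg K E).
Local Notation gst := (@gst K E).
Local Notation mon := (@mon K E).
Local Notation gmon := (@gmon K E).
Implicit Types (u v w : vertex E) (e f : edge E) (p q t : seq (edge E)).
Implicit Types (a b x y : L) (s : seq (K * seq (edge E))).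

Definition into v p := if p is e :: _ then walk (src e) p v else true.

Lemma intoP v p : reflect (exists u, walk u p v) (into v p).
Proof.
case: p => [|e p] /=; first by constructor; exists v => /=.
rewrite eqxx; apply: (iffP idP) => [h|[u /andP[_ //]]].
by exists (src e); rewrite eqxx.
Qed.

Lemma walk_start u v p w : walk u p w -> walk v p w = (v == u).
Proof.
case: p => [/eqP ->|e p /= /andP[/eqP -> ->]] //=.
by rewrite andbT eq_sym.
Qed.

Lemma vtx_monE v u p w : walk u p w ->
  vtx v ** mon p w = if walk v p w then mon p w else 0.
Proof.
move=> up; rewrite (walk_start v up) -{1}(vtx_mon K up) rmulA vtxM.
by case: eqP => [->|_]; rewrite ?rmul0r // vtx_mon.
Qed.

(** The bound on the sizes excludes the case where [q] is a proper prefix of [p] and a ghost path is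
    left over. The walk test matters for empty [p], when [q] may start elsewhere. *)
Lemma gmon_monE u v w p q : walk u p v -> into w q -> (size p <= size q)%N ->
  gmon p v ** mon q w =
    if prefix p q && walk v (drop (size p) q) w then mon (drop (size p) q) w
    else 0.
Proof.
move=> up /intoP[u' uq] pq.
elim: p u u' q up uq pq => [|e p ih] u u' [|f q] //=.
- by move=> _ uq _; rewrite -/(mon [::] w) (vtx_monE v (uq : walk u' [::] w)).
- by move=> _ uq _; rewrite -/(mon (f :: q) w) (vtx_monE v (uq : walk u' (f :: q) w)).
move=> /andP[_ pv] /andP[_ qw]; rewrite ltnS -rmulA [gst e ** _]rmulA gst_edg => sz.
case: eqVneq => [ef|_] /=; last by rewrite rmul0r rmulr0.
by rewrite ef vtx_mon // (ih (rge e) (rge f)).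
Qed.

Definition rcomb v s : L := \sum_(c <- s) c.1 *: mon c.2 v.

(** This is the span of the products [p q^*] where [q] starts at [v] and has at most [n] edges; [n]
    is the induction measure for eliminating ghosts. *)
Inductive span_gst : nat -> vertex E -> L -> Prop :=
| span_mon n u p v : walk u p v -> span_gst n v (mon p v)
| span_ghost n e x : span_gst n (rge e) x -> span_gst n.+1 (src e) (x ** gst e)
| span0 n v : span_gst n v 0
| spanD n v x y : span_gst n v x -> span_gst n v y -> span_gst n v (x + y)
| spanZ n v k x : span_gst n v x -> span_gst n v (k *: x).

Lemma span_gst_leq m n v x : (m <= n)%N -> span_gst m v x -> span_gst n v x.
Proof.
move=> mn h; elim: h n mn => {m v x}.
- by move=> m u p v up n _; exact: span_mon up.
- by move=> m e x _ ih [|n] // mn; apply: span_ghost; exact: ih.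
- by move=> *; exact: span0.
- by move=> m v x y _ hx _ hy n mn; apply: spanD; [exact: hx|exact: hy].
- by move=> m v k x _ hx n mn; apply: spanZ; exact: hx.
Qed.

Lemma span_vtx n v x : span_gst n v x -> x ** vtx v = x.
Proof.
elim=> {n v x} [n u p v _|n e x _ _|n v|n v x y _ hx _ hy|n v k x _ hx].
- exact: mon_vtx.
- by rewrite -rmulA gst_src.
- exact: rmul0r.
- by rewrite rmulDl hx hy.
- by rewrite -rscaleAl hx.
Qed.

Lemma mon1 e : mon [:: e] (rge e) = edg e.
Proof. exact: edg_rge. Qed.

Lemma mon_edg p e : mon p (src e) ** edg e = mon (rcons p e) (rge e).
Proof. by rewrite -mon1 (mon_cat K p (walk1 e)) cats1. Qed.

Lemma walk_rcons u p e : walk u p (src e) -> walk u (rcons p e) (rge e).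
Proof. by move=> up; rewrite -cats1; exact: walk_cat up (walk1 e). Qed.

(** The edge cancels a final ghost of itself, kills a final ghost of another edge, and only
    lengthens a monomial without ghosts. *)
Lemma span_edg n e x : span_gst n.+1 (src e) x -> span_gst n (rge e) (x ** edg e).
Proof.
move: {1 3}(src e) (erefl (src e)) {1 3}n.+1 (erefl n.+1) => v ev m mn h.
elim: h n mn ev => {m v x}.
- move=> m u p v up n _ ev; subst v; rewrite mon_edg.
  exact: span_mon (walk_rcons up).
- move=> m f x hx _ n [mn] ef; subst m; rewrite -rmulA gst_edg.
  case: eqP => [fe|_]; last by rewrite rmulr0; exact: span0.
  by rewrite fe in hx *; rewrite (span_vtx hx).
- by move=> *; rewrite rmul0r; exact: span0.
- move=> m v x y _ hx _ hy n mn ev; rewrite rmulDl.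
  by apply: spanD; [exact: hx|exact: hy].
- by move=> m v k x _ hx n mn ev; rewrite -rscaleAl; apply: spanZ; exact: hx.
Qed.

Lemma rcomb_scale v k s : k *: rcomb v s = rcomb v [seq (k * c.1, c.2) | c <- s].
Proof.
by rewrite /rcomb big_map scaler_sumr; apply: eq_bigr => c _; rewrite scalerA.
Qed.

(* Multiplying by [v - \sum_(e <- T) e e^*] kills the monomials ending with the
   ghost of an edge in [T]. *)
Lemma span_ghost_free n v x : span_gst n v x ->
  exists s (T0 : seq (edge E)), [/\ all (fun c => into v c.2) s,
    (n = 0 -> T0 = [::]) /\ all (fun e => src e == v) T0 &
    forall T : seq (edge E), uniq T -> {subset T0 <= T} ->
      x ** (vtx v - \sum_(e <- T) edg e ** gst e) =
      rcomb v s ** (vtx v - \sum_(e <- T) edg e ** gst e)].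
Proof.
elim=> {n v x}.
- move=> n u p v up; exists [:: (1, p)], [::]; split=> //.
    by rewrite /= andbT; apply/intoP; exists u.
  by move=> T _ _; rewrite /rcomb big_seq1 scale1r.
- move=> n e x _ _; exists [::], [:: e]; split; rewrite /= ?eqxx // => T uT eT.
  have {}eT : e \in T by apply: eT; rewrite inE.
  rewrite /rcomb big_nil rmul0r rmulBr -!rmulA gst_src rmul_sumr.
  rewrite (bigD1_seq e) //= big1 => [|f /negPf fe].
    by rewrite addr0 [gst e ** _]rmulA gst_edgK rge_gst subrr.
  by rewrite rmulA gst_edg eq_sym fe rmul0r.
- by move=> n v; exists [::], [::]; split=> // T _ _; rewrite /rcomb big_nil.
- move=> n v x y _ [s [S [hs [nS vS] hS]]] _ [t [T [ht [nT vT] hT]]].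
  exists (s ++ t), (S ++ T); split; first by rewrite all_cat hs ht.
    by rewrite all_cat vS vT; split=> // n0; rewrite nS ?nT.
  move=> U uU hU; rewrite rmulDl hS ?hT //.
  - by rewrite -rmulDl /rcomb big_cat.
  - by move=> e eT; apply: hU; rewrite mem_cat eT orbT.
  - by move=> e eT; apply: hU; rewrite mem_cat eT.
- move=> n v k x _ [s [S [hs nS hS]]].
  exists [seq (k * c.1, c.2) | c <- s], S; split=> //; first by rewrite all_map.
  by move=> T uT hT; rewrite -rcomb_scale -!rscaleAl hS.
Qed.

(* The coefficient of [p] is nonzero only formally: [x != 0] would need the
   linear independence of paths, which is never used. *)
Definition lead_form v x := exists k p s,
  [/\ k != 0, into v p, x = k *: mon p v + rcomb v s &
      all (fun c => [&& into v c.2, c.2 != p & (size p <= size c.2)%N]) s].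

(** Take a shortest path that occurs and add up its coefficients. A nonzero sum gives the leading
    term; otherwise all its occurrences are dropped and the list gets shorter. *)
Lemma rcomb_lead v s : all (fun c => into v c.2) s ->
  rcomb v s = 0 \/ lead_form v (rcomb v s).
Proof.
have [n] := ubnP (size s); elim: n s => // n ih s; rewrite ltnS => sn hs.
have [->|s0] := eqVneq s [::]; first by left; rewrite /rcomb big_nil.
have ex : exists m, has (fun c => size c.2 == m) s.
  by case: s {sn hs} s0 => // c s _; exists (size c.2); rewrite /= eqxx.
case: (ex_minnP ex) => m /hasP[[k0 p] ps /= /eqP pm] mmin.
pose S1 := [seq c <- s | c.2 == p]; pose S2 := [seq c <- s | c.2 != p].
pose k := \sum_(c <- S1) c.1.
have sE : rcomb v s = k *: mon p v + rcomb v S2.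
  rewrite {1}/rcomb (bigID (fun c : K * _ => c.2 == p)) /= /rcomb big_filter; congr +%R.
  rewrite /k big_filter scaler_suml; apply: eq_bigr => c /eqP -> //.
have [k00|kn0] := eqVneq k 0.
  rewrite sE k00 scale0r add0r; apply: ih; last first.
    by apply/allP => c; rewrite mem_filter => /andP[_ /(allP hs)].
  rewrite (leq_trans _ sn) // size_filter ltn_neqAle count_size andbT -all_count.
  by apply/allPn; exists (k0, p); rewrite ?negbK /=.
right; exists k, p, S2; split=> //; first exact: (allP hs _ ps).
apply/allP => c; rewrite mem_filter => /andP[-> cs]; rewrite (allP hs) //=.
by rewrite pm; apply: mmin; apply/hasP; exists c.
Qed.

Lemma lead_form_edg e x : lead_form (src e) x -> lead_form (rge e) (x ** edg e).
Proof.
have into_rcons p : into (src e) p -> into (rge e) (rcons p e).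
  by move=> /intoP[u up]; apply/intoP; exists u; exact: walk_rcons.
move=> [k [p [s [k0 pv -> hs]]]].
exists k, (rcons p e), [seq (c.1, rcons c.2 e) | c <- s]; split=> //.
- exact: into_rcons.
- rewrite rmulDl -rscaleAl mon_edg; congr +%R.
  rewrite /rcomb rmul_suml big_map; apply: eq_bigr => c _.
  by rewrite -rscaleAl mon_edg.
rewrite all_map; apply/allP => c /(allP hs) /and3P[cv cp sz] /=.
by rewrite into_rcons // eqseq_rcons eqxx andbT cp !size_rcons ltnS.
Qed.

Lemma rcomb_vtx v s : rcomb v s ** vtx v = rcomb v s.
Proof.
by rewrite /rcomb rmul_suml; apply: eq_bigr => c _; rewrite -rscaleAl mon_vtx.
Qed.

Lemma rcomb_reduce v s : all (fun c => into v c.2) s -> rcomb v s != 0 ->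
  exists w q, walk v q w /\ lead_form w (rcomb v s ** mon q w).
Proof.
move=> hs s0; exists v, [::]; rewrite /= eqxx rcomb_vtx; split=> //.
by case: (rcomb_lead hs) => // r0; rewrite r0 eqxx in s0.
Qed.

(** Induction on the bound for ghosts. An edge [e] with [x e] nonzero lowers it; if there is none,
    [x] is compared with its ghost-free part [rcomb v s]. *)
Lemma reduce_to_real n v x : span_gst n v x -> x != 0 ->
  exists w q, walk v q w /\ lead_form w (x ** mon q w).
Proof.
elim: n v x => [|n ih] v x hx x0; have xv := span_vtx hx;
  have [s [T0 [hs [nT vT] hT]]] := span_ghost_free hx.
  have xE : x = rcomb v s.
    by have := hT [::] isT; rewrite big_nil subr0 xv rcomb_vtx nT //; apply.
  by rewrite xE in x0 *; exact: rcomb_reduce.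
have [[e ev xe]|nxe] := pselect (exists2 e, src e = v & x ** edg e != 0).
  subst v; have [w [q [eq lq]]] := ih _ _ (span_edg hx) xe.
  by exists w, (e :: q); rewrite /= eqxx rmulA.
have {}nxe e : src e = v -> x ** edg e = 0.
  by move=> ev; apply: contrapT => /eqP xe; apply: nxe; exists e.
(* As [x] annihilates all edges from [v], subtracting the terms [x e e^*] from [x] changes
   nothing. *)
have xE (T : seq (edge E)) : uniq T -> {subset T0 <= T} ->
    {in T, forall e, src e = v} ->
    x = rcomb v s ** (vtx v - \sum_(e <- T) edg e ** gst e).
  move=> uT hT0 Tv; rewrite -hT // rmulBr xv rmul_sumr big_seq big1 ?subr0 // => e eT.
  by rewrite rmulA nxe ?rmul0r // Tv.
have sT0 : {subset T0 <= undup T0} by move=> e; rewrite mem_undup.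
have vT0 : {in undup T0, forall e, src e = v}.
  by move=> e; rewrite mem_undup => /(allP vT)/eqP.
(* An edge [f] outside [T0] is killed by every ghost in the sum, so [x f] equals [rcomb v s] times
   [f]. *)
have [[f fv fT]|nf] := pselect (exists2 f, src f = v & f \notin T0).
  subst v; have xs := xE _ (undup_uniq T0) sT0 vT0.
  exists (rge f), [:: f]; split; first exact: walk1.
  have -> : x ** mon [:: f] (rge f) = rcomb (src f) s ** edg f.
    rewrite mon1 xs -rmulA rmulBl src_edg rmul_suml big_seq big1 ?subr0 // => e.
    rewrite mem_undup -rmulA gst_edg => eT; case: eqP => [ef|_]; last exact: rmulr0.
    by rewrite ef (negPf fT) in eT.
  apply: lead_form_edg; case: (rcomb_lead hs) => // r0.
  by rewrite xs r0 rmul0r eqxx in x0.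
(* Now [T0] contains all edges from [v], so they are finitely many: relation (4) forces [x = 0]
   unless [v] is a sink, where the sum is empty. *)
have T0E e : src e = v -> e \in T0.
  by move=> ev; apply: contrapT => /negP eT; apply: nf; exists e.
have fin : finite_set (emits v).
  apply: sub_finite_set (finite_seq T0); exact: T0E.
have memT e : (e \in fset_set (emits v)) = (src e == v).
  by rewrite in_fset_set //; apply/idP/eqP; rewrite inE.
have [[f fv]|em] := pselect (emits v !=set0).
  have /xE : uniq (fset_set (emits v)) by exact: fset_uniq.
  rewrite -(lf_ck2 (LPA_leavitt_family K E)); last by split=> //; exists f.
  rewrite subrr rmulr0 => xz; rewrite xz ?eqxx // in x0.
    by move=> e /(allP vT); rewrite memT.
  by move=> e; rewrite memT => /eqP.
have {}xE : x = rcomb v s.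
  rewrite (xE [::]) ?big_nil ?subr0 ?rcomb_vtx //.
  by move=> e /(allP vT) /eqP ev; case: em; exists e.
by rewrite xE in x0 *; exact: rcomb_reduce.
Qed.

End Reduction.

(** * Combinations of closed paths at a vertex, and their action *)

Section ClosedForms.
Variables (K : fieldType) (E : graph).
Local Notation L := (LPA K E).
Local Notation vtx := (@vtx K E).
Local Notation edg := (@edg K E).
Local Notation gst := (@gst K E).
Local Notation mon := (@mon K E).
Local Notation gmon := (@gmon K E).
Implicit Types (u v w : vertex E) (e f : edge E) (p q t : seq (edge E)).
Implicit Types (a b x y : L) (s : seq (K * seq (edge E))).

(** Left multiplication does not touch the ghosts on the right, so it suffices to treat real paths.
    The bound 1 allows for [b = e^*], which stays a ghost when it meets a path of length 0. *)
Lemma span_gst_mul n v b x :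
  (forall u p v', walk u p v' -> span_gst 1 v' (b ** mon p v')) ->
  span_gst n v x -> span_gst n.+1 v (b ** x).
Proof.
move=> hb; elim=> {n v x}.
- by move=> n u p v up; apply: span_gst_leq (hb _ _ _ up).
- by move=> n e x _ ih; rewrite rmulA; exact: span_ghost.
- by move=> n v; rewrite rmulr0; exact: span0.
- by move=> n v x y _ hx _ hy; rewrite rmulDr; exact: spanD.
- by move=> n v k x _ hx; rewrite -rscaleAr; exact: spanZ.
Qed.

Lemma span_gst_lmul a n v x : span_gst n v x -> exists m, span_gst m v (a ** x).
Proof.
elim/lpa_ind: a; move=> a; elim: a n x => [u|e|e||a ha b hb|a ha|k a ha|a ha b hb] n x hx.
- exists n.+1; apply: span_gst_mul hx => v' p w up.
  rewrite -/(vtx u) (vtx_monE K u up); case: ifP => _; last exact: span0.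
  exact: span_mon up.
- exists n.+1; apply: span_gst_mul hx => u p w up; rewrite -/(edg e) -edg_rge -rmulA.
  rewrite (vtx_monE K _ up); case: ifP => ep; last by rewrite rmulr0; exact: span0.
  by apply: (@span_mon K E 1 (src e) (e :: p) w); rewrite /= eqxx.
- exists n.+1; apply: span_gst_mul hx => u [|f p] w up; rewrite -/(gst e).
    rewrite -gst_src -rmulA (vtx_monE K _ up) /=.
    case: eqP => [<-|_]; last by rewrite rmulr0; exact: span0.
    rewrite gst_src -rge_gst; apply: span_ghost.
    by apply: (@span_mon K E 0 (rge e) [::] (rge e)) => /=.
  rewrite /= rmulA gst_edg; case: eqP => [->|_]; last by rewrite rmul0r; exact: span0.
  move: up => /andP[_ up]; rewrite -/(mon p w) vtx_mon //; exact: span_mon up.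
- by exists n; rewrite lpa_class0 rmul0r; exact: span0.
- have [i hi] := ha _ _ hx; have [j hj] := hb _ _ hx; exists (maxn i j).
  rewrite lpa_classD rmulDl; apply: spanD; [apply: span_gst_leq hi|apply: span_gst_leq hj].
    exact: leq_maxl.
  exact: leq_maxr.
- have [i hi] := ha _ _ hx; exists i; rewrite lpa_classN -scaleN1r -rscaleAl.
  exact: spanZ.
- have [i hi] := ha _ _ hx; exists i; rewrite lpa_classZ -rscaleAl.
  exact: spanZ.
have [i hi] := hb _ _ hx; have [j hj] := ha _ _ hi.
by exists j; rewrite lpa_classM -rmulA.
Qed.

Lemma span_gst_total a v : exists n, span_gst n v (a ** vtx v).
Proof.
by apply: (@span_gst_lmul a 0 v); apply: (@span_mon K E 0 v [::] v) => /=.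
Qed.

Definition closed_form w k s x := x = k *: vtx w + rcomb w s /\
  all (fun c => (c.2 != [::]) && walk w c.2 w) s.

(** Multiply by [p^*]. As [p] is shortest, every other path loses the prefix [p] or dies, and what
    remains is nonempty because the path differs from [p]. *)
Lemma lead_form_closed v x : lead_form v x ->
  exists b k s, k != 0 /\ closed_form v k s (b ** x).
Proof.
move=> [k [p [s [k0 pv -> hs]]]]; have [u up] := intoP _ _ pv.
exists (gmon p v), k, [seq (c.1, drop (size p) c.2) | c <- s &
  prefix p c.2 && walk v (drop (size p) c.2) v].
split=> //; split.
  rewrite rmulDr -rscaleAr (gmonK _ up); congr +%R.
  rewrite /rcomb rmul_sumr big_map big_filter [RHS]big_mkcond big_seq [RHS]big_seq.
  apply: eq_bigr => c /(allP hs)/and3P[cv _ cp].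
  by rewrite -rscaleAr (gmon_monE _ up) //; case: ifP; rewrite ?scaler0.
rewrite all_map; apply/allP => c; rewrite mem_filter /= => /andP[/andP[pc ->] cs].
rewrite andbT; have /and3P[_ cp _] := allP hs _ cs.
apply: contraNneq cp => c0; case/prefixP: pc c0 => t ->.
by rewrite drop_size_cat // => ->; rewrite cats0.
Qed.

(* Sandwiching by [t] conjugates each closed path [c] into [t^-1 c t], or kills
   it when [t] is not a prefix of [c t]. *)
Lemma closed_form_conj w k s x t r : walk w t r -> closed_form w k s x ->
  exists s', closed_form r k s' (gmon t r ** x ** mon t r) /\
    s' = [seq (c.1, drop (size t) (c.2 ++ t)) | c <- s &
      prefix t (c.2 ++ t) && walk r (drop (size t) (c.2 ++ t)) r].
Proof.
move=> wt [-> hs]; eexists; split; last by reflexivity.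
split.
  rewrite rmulDr rmulDl -rscaleAr -rscaleAl (gmon_vtx K wt) (gmonK K wt); congr +%R.
  rewrite /rcomb rmul_sumr rmul_suml big_map big_filter [RHS]big_mkcond big_seq.
  rewrite [RHS]big_seq; apply: eq_bigr => c /(allP hs)/andP[_ cw].
  rewrite -rscaleAr -rscaleAl -rmulA (mon_cat K _ wt) (gmon_monE K wt).
  - by case: ifP; rewrite ?scaler0.
  - by apply/intoP; exists w; exact: walk_cat cw wt.
  - by rewrite size_cat leq_addl.
rewrite all_map; apply/allP => c; rewrite mem_filter /= => /andP[/andP[_ ->] cs].
have /andP[c0 _] := allP hs _ cs; rewrite andbT -size_eq0 size_drop size_cat.
by rewrite addnK size_eq0.
Qed.

Definition no_bifurcation w := forall u, reaches w u -> ~ bifurcation u.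

(** When a path [t] leads to a bifurcation, conjugating by [t g] for a suitable edge [g] there kills
    a chosen closed path, so the number of terms drops. *)
Lemma closed_form_reduce w k s x : closed_form w k s x ->
  exists l r v s', closed_form v k s' (l ** x ** r) /\
    (s' = [::] \/ no_bifurcation v).
Proof.
have [n] := ubnP (size s); elim: n w s x => // n ih w s x; rewrite ltnS => sn hx.
have wid : vtx w ** x ** vtx w = x.
  case: hx => -> hs; rewrite rmulDr rmulDl -rscaleAr -rscaleAl !vtxMid; congr +%R.
  rewrite -rmulA rcomb_vtx /rcomb rmul_sumr big_seq [RHS]big_seq.
  apply: eq_bigr => c /(allP hs)/andP[_ cw].
  by rewrite -rscaleAr vtx_mon.
have [s0|s0] := eqVneq s [::].
  by exists (vtx w), (vtx w), w, s; rewrite wid; split=> //; left.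
have [nb|/existsNP[u]] := pselect (no_bifurcation w).
  by exists (vtx w), (vtx w), w, s; rewrite wid; split=> //; right.
move=> /not_implyP[/reachesP[t wt]] /contrapT [e [f [eu fu ef]]].
have [c cs] : exists c, c \in s by case: (s) s0 => // c ? _; exists c; rewrite inE eqxx.
have [c0 cw] := andP (allP (proj2 hx) _ cs).
(* As [c] is nonempty, the first [size t + 1] edges of [c t g] lie in [c t]; the distinct paths
   [t e] and [t f] of that length cannot both be its prefix. *)
have [g gu gp] : exists2 g, src g = u & ~~ prefix (rcons t g) (c.2 ++ rcons t g).
  apply: contrapT => ng; have pg g : src g = u -> prefix (rcons t g) (c.2 ++ t).
    move=> gu; have : prefix (rcons t g) (c.2 ++ rcons t g).
      by apply: contrapT => /negP h; apply: ng; exists g.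
    rewrite !prefixE -!cats1 catA takel_cat // !size_cat /= addnC leq_add2r.
    by case: (c.2) c0.
  have := pg e eu; have := pg f fu; rewrite !prefixE !size_rcons => /eqP -> /eqP.
  by move/rcons_inj => -[fe]; case: ef.
have wt' : walk w (rcons t g) (rge g) by subst u; exact: walk_rcons.
have [s' [hs' s'E]] := closed_form_conj wt' hx.
have s'n : (size s' < n)%N.
  rewrite (leq_trans _ sn) // s'E size_map size_filter ltn_neqAle count_size andbT.
  by rewrite -all_count; apply/allPn; exists c => //; rewrite (negPf gp).
have [l [r [v [s'' [h1 h2]]]]] := ih _ _ _ s'n hs'.
exists (l ** gmon (rcons t g) (rge g)), (mon (rcons t g) (rge g) ** r), v, s''.
by split=> //; rewrite !rmulA in h1 *.
Qed.

Lemma reduction a : a != 0 -> exists l r w k s,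
  [/\ k != 0, closed_form w k s (l ** a ** r) & s = [::] \/ no_bifurcation w].
Proof.
move=> /exists_vtx_neq0[v av]; have [n sn] := span_gst_total a v.
have [w [q [vq /lead_form_closed[b [k [s [k0 /closed_form_reduce]]]]]]] :=
  reduce_to_real sn av.
move=> [l [r [w' [s' [h1 h2]]]]]; exists (l ** b), (vtx v ** mon q w ** r), w', k, s'.
by split=> //; rewrite !rmulA in h1 *.
Qed.

Lemma no_bifurcation_reaches u w : no_bifurcation u -> reaches u w -> no_bifurcation w.
Proof. by move=> nb uw v wv; apply: nb; exact: reaches_trans uw wv. Qed.

Let z : {fraction {poly K}} := tofrac 'X.

Lemma lact_mon_indicator u t w : no_bifurcation u -> walk u t w ->
  lact (mon t w) (indicator K w) = fun i => z ^+ size t * indicator K u i.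
Proof.
elim: t u => [|e t ih] u nb /=.
  by move=> /eqP <-; rewrite lact_vtx_indicator; apply/funext=> i; rewrite mul1r.
move=> /andP[/eqP eu tw]; subst u; rewrite lactM -/(mon t w) (ih (rge e)) //; last first.
  by apply: no_bifurcation_reaches nb _; apply/reachesP; exists [:: e]; exact: walk1.
rewrite lact_scale lact_edg_indicator; last by apply: nb; left.
by apply/funext=> i; rewrite mulrA exprSr.
Qed.

Lemma closed_form_act w k s x : no_bifurcation w -> k != 0 -> closed_form w k s x ->
  exists2 c : {fraction {poly K}}, c != 0 &
    lact x (indicator K w) = fun i => c * indicator K w i.
Proof.
move=> nb k0 [-> hs].
(* Each closed path acts as [z] to its length. These lengths are positive, so the constant term is
   [k]. *)
exists (tofrac (k%:P + \sum_(c <- s) c.1%:P * 'X^(size c.2))).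
  rewrite tofrac_eq0; apply: contraNneq k0 => /(congr1 (fun r : {poly K} => r.[0])).
  rewrite !hornerE horner_sum big_seq big1 ?addr0 => [->//|c /(allP hs)/andP[c0 _]].
  by rewrite !hornerE expr0n size_eq0 (negPf c0) mulr0.
apply/funext=> i; rewrite lactD lactZ lact_vtx_indicator tofracD mulrDl; congr +%R.
rewrite (big_morph (fun a => lact a _ i) (fun a b => lactD a b _ i) (lact0 _ i)).
rewrite (big_morph (@tofrac _) (@tofracD _) (tofrac0 _)) mulr_suml big_seq.
rewrite [RHS]big_seq; apply: eq_bigr => c /(allP hs)/andP[_ cw].
by rewrite lactZ (lact_mon_indicator nb cw) tofracM tofracXn mulrA.
Qed.

(* Left multiplication by [w - e t], [e t] being the closed path, cannot be
   undone: it acts on the indicator of [w] as [1 - z ^ d]. *)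
Lemma closed_form_not_minimal w e t k s x :
  no_bifurcation w -> walk w (e :: t) w -> k != 0 -> closed_form w k s x ->
  ~ (forall b, b ** x != 0 -> exists a, a ** (b ** x) = x).
Proof.
move=> nb wt k0 hx hmin; have [c c0 xE] := closed_form_act nb k0 hx.
pose b := vtx w - mon (e :: t) w; pose d := 1 - z ^+ (size t).+1.
have d0 : d != 0.
  rewrite /d /z -tofracXn -tofrac1 -tofracB tofrac_eq0.
  apply/eqP=> /(congr1 (fun r : {poly K} => r.[0])); rewrite !hornerE expr0n subr0.
  by move/eqP; rewrite oner_eq0.
have bE : lact b (indicator K w) = fun i => d * indicator K w i.
  apply/funext=> i; rewrite lactD lactN lact_vtx_indicator.
  by rewrite (lact_mon_indicator nb wt) mulrBl mul1r.
have bxE : lact (b ** x) (indicator K w) = fun i => c * (d * indicator K w i).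
  by rewrite lactM xE lact_scale bE.
(* The product [b x] acts by the nonzero factor [c d]. If [a] recovers [x] from it, cancelling [c]
   shows that [a] undoes [d] on the indicator. *)
have [|a ax] := hmin b.
  apply/eqP=> bx0; have [i wi] := indicator_neq0 K w.
  have /(congr1 (@^~ i)) := bxE; rewrite bx0 lact0 wi mulr1 => /esym/eqP.
  by rewrite mulf_eq0 (negPf c0) (negPf d0).
apply: (@lact_not_inverse K E a w (size t).+1) => // i.
have := xE; rewrite -ax lactM bxE !lact_scale => /(congr1 (@^~ i)).
exact: mulfI.
Qed.

Lemma edg_gst e : ~ bifurcation (src e) -> edg e ** gst e = vtx (src e).
Proof.
move=> nb; rewrite (lf_ck2 (LPA_leavitt_family K E) (regular1 nb)).
by rewrite emits1 // fset_set1 big_seq_fset1.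
Qed.

Lemma mon_gmon u p w : no_bifurcation u -> walk u p w ->
  mon p w ** gmon p w = vtx u.
Proof.
elim: p u => [|e p ih] u nb /=; first by move=> /eqP ->; exact: vtxMid.
move=> /andP[/eqP eu pw]; subst u; rewrite -rmulA [foldr _ _ _ ** _]rmulA.
rewrite [X in _ ** (X ** _)](ih (rge e)) //; last first.
  by apply: no_bifurcation_reaches nb _; apply/reachesP; exists [:: e]; exact: walk1.
by rewrite rge_gst edg_gst //; apply: nb; left.
Qed.

Lemma line_point_no_bifurcation u : line_points E u -> no_bifurcation u.
Proof. by move=> lu w /lu[]. Qed.

Lemma line_point_left_inverse u x : line_points E u -> x ** vtx u = x -> x != 0 ->
  exists y, y ** x = vtx u.
Proof.
move=> lu xu x0; have nb := line_point_no_bifurcation lu.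
have [n] := span_gst_total x u; rewrite xu => /reduce_to_real/(_ x0).
move=> [w [q [uq /lead_form_closed[b [k [s [k0 [bx hs]]]]]]]].
have s0 : s = [::].
  case: s hs bx => // -[c [|e t]] s //= /andP[wt _] _.
  by case: (@line_point_no_closed_walk _ _ w e t lu _ wt); apply/reachesP; exists q.
(* Here [b x q = k w]; inserting [u = q q^*] after [x] gives [k^-1 q b x = q q^* = u]. *)
exists (k^-1 *: (mon q w ** b)).
rewrite -rscaleAl -[X in _ ** X]xu -(mon_gmon nb uq).
rewrite -rmulA [x ** _]rmulA [b ** _]rmulA bx s0 /rcomb big_nil addr0.
by rewrite -rscaleAl -rscaleAr scalerA mulVf // scale1r vtx_gmon.
Qed.

End ClosedForms.

(** * Minimal left ideals and the socle in rings without unit *)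

Section Socle.
Variable R : rngType.
Implicit Types (I J : set R) (a x y : R).

Lemma additive_subgroup_smallest (X : set R) :
  additive_subgroup (smallest (@additive_subgroup R) X).
Proof.
split=> [I [[I0 _ _] _] //|x y hx hy I IX|x hx I IX]; have [[_ ID IN] _] := IX.
  by apply: ID; [exact: hx|exact: hy].
by apply: IN; exact: hx.
Qed.

Lemma two_sided_ideal_gen (X : set R) : two_sided_ideal (ideal_gen X).
Proof.
split; first split.
- by move=> I [[[I0 _ _] _ _] _].
- by move=> x y hx hy I IX; case: (IX) => -[[_ ID _] _ _] _; apply: ID; [exact: hx|exact: hy].
- by move=> x hx I IX; case: (IX) => -[[_ _ IN] _ _] _; apply: IN; exact: hx.
- by move=> a x hx I IX; case: (IX) => -[_ Il _] _; apply: Il; exact: hx.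
- by move=> a x hx I IX; case: (IX) => -[_ _ Ir] _; apply: Ir; exact: hx.
Qed.

Lemma nonzero_mem I : I 0 -> I <> [set 0] -> exists2 x, I x & x != 0.
Proof.
move=> I0 In; apply: contrapT => h; apply: In; apply/seteqP; split=> x /=.
  by move=> Ix; apply: contrapT => /eqP x0; apply: h; exists x.
by move=> ->.
Qed.

Lemma left_ideal_mulr I a : left_ideal I -> left_ideal [set x ** a | x in I].
Proof.
move=> [[I0 ID IN] Il]; split; first split.
- by exists 0; rewrite ?rmul0r.
- by move=> _ _ [x Ix <-] [y Iy <-]; exists (x + y); rewrite ?rmulDl //; exact: ID.
- by move=> _ [x Ix <-]; exists (- x); rewrite ?rmulNr //; exact: IN.
by move=> b _ [x Ix <-]; exists (b ** x); rewrite ?rmulA //; exact: Il.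
Qed.

(** A nonzero left ideal inside [I a] pulls back along right multiplication by [a] to a nonzero left
    ideal inside [I], which is then all of [I]. *)
Lemma minimal_left_ideal_mulr I a : minimal_left_ideal I ->
  [set x ** a | x in I] <> [set 0] -> minimal_left_ideal [set x ** a | x in I].
Proof.
move=> [Il _ Imin] Ia0; split=> //; first exact: left_ideal_mulr.
move=> J [[J0 JD JN] Jl] JIa Jn; apply/seteqP; split=> // _ [x Ix <-].
have [[I0 ID IN] IlM] := Il.
suff IE : [set y | I y /\ J (y ** a)] = I by move: Ix; rewrite -{1}IE => -[].
apply: Imin.
- split; first split=> [|y z [Iy Jy] [Iz Jz]|y [Iy Jy]] /=.
  + by rewrite rmul0r.
  + by rewrite rmulDl; split; [exact: ID|exact: JD].
  + by rewrite rmulNr; split; [exact: IN|exact: JN].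
  by move=> b y /= [Iy Jy]; rewrite -rmulA; split; [exact: IlM|exact: Jl].
- by move=> y [].
have [j Jj j0] := nonzero_mem J0 Jn; have [y Iy ya] := JIa _ Jj => h.
have : [set y | I y /\ J (y ** a)] y by split=> //; rewrite ya.
by rewrite h /= => y0; rewrite -ya y0 rmul0r eqxx in j0.
Qed.

(** The elements that a given multiplication sends into the socle form a subgroup, so a single
    minimal left ideal [I] can be treated; [I a] is minimal or zero. *)
Lemma socle_two_sided : two_sided_ideal (socle R).
Proof.
have sub := additive_subgroup_smallest (\bigcup_(I in @minimal_left_ideal R) I).
have [S0 SD SN] := sub.
split=> // a.
  apply: (smallest_sub (X := [set x | socle R (a ** x)])).
    split=> [|x y|x] /=; rewrite ?rmulr0 ?rmulDr ?rmulrN //; first exact: SD.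
    exact: SN.
  move=> x [I Imin Ix] /=; apply: sub_gen_smallest; exists I => //.
  by have [[_ Il] _ _] := Imin; exact: Il.
apply: (smallest_sub (X := [set x | socle R (x ** a)])).
  split=> [|x y|x] /=; rewrite ?rmul0r ?rmulDl ?rmulNr //; first exact: SD.
  exact: SN.
move=> x [I Imin Ix] /=.
have xaI : [set x ** a | x in I] (x ** a) by exists x.
have [I0|I0] := pselect ([set x ** a | x in I] = [set 0]).
  by move: xaI; rewrite I0 /= => ->.
by apply: sub_gen_smallest; exists [set x ** a | x in I] => //; exact: minimal_left_ideal_mulr.
Qed.

End Socle.

(** * The socle of a Leavitt path algebra *)

Section SocleLPA.
Variables (K : fieldType) (E : graph).
Local Notation L := (LPA K E).
Local Notation vtx := (@vtx K E).
Local Notation edg := (@edg K E).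
Local Notation gst := (@gst K E).
Local Notation mon := (@mon K E).
Local Notation gmon := (@gmon K E).
Implicit Types (u v w : vertex E) (e f : edge E) (p q t : seq (edge E)).
Implicit Types (a b x y : L) (X : set (vertex E)) (M J : set L).

(** The vertices in an ideal form a hereditary set, since [w = p^* v p] for a path [p] from [v] to
    [w], and a saturated one by relation (4). *)
Lemma lpa_ideal_hs_closure X : lpa_ideal K X = lpa_ideal K (hs_closure X).
Proof.
have [[I0 ID _] Il Ir] := two_sided_ideal_gen (vtx @` X).
apply/seteqP; split; apply: smallest_sub; try exact: two_sided_ideal_gen.
  move=> _ [v Xv <-]; apply: sub_gen_smallest; exists v => //.
  exact: sub_gen_smallest.
move=> _ [v Hv <-]; move: v Hv.
apply: (smallest_sub (X := [set v | lpa_ideal K X (vtx v)])); last first.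
  by move=> v Xv; apply: sub_gen_smallest; exists v.
split=> [v w Iv /reachesP[p vp]|v vr sub] /=.
  by rewrite -(gmonK K vp) -{1}(gmon_vtx K vp) -rmulA; apply: Il; exact: Ir.
rewrite (lf_ck2 (LPA_leavitt_family K E) vr) big_seq.
apply: (big_ind (lpa_ideal K X)) => // e.
rewrite (in_fset_set (proj1 vr)) => /set_mem ev.
by rewrite -(edg_rge K e) -rmulA; apply: Il; apply: Ir; apply: sub; exists e.
Qed.

Lemma line_point_minimal u : line_points E u -> minimal_left_ideal [set a ** vtx u | a in setT].
Proof.
move=> lu; split.
- apply: left_ideal_mulr; split=> //; split=> //.
- move=> h; have : [set a ** vtx u | a in setT] (vtx u).
    by exists (vtx u) => //; exact: vtxMid.
  by rewrite h /=; apply/eqP; exact: vtx_neq0.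
move=> J [[J0 _ _] Jl] Ju Jn; apply/seteqP; split=> // _ [a _ <-].
have [x Jx x0] := nonzero_mem J0 Jn.
have xu : x ** vtx u = x by have [b _ <-] := Ju _ Jx; rewrite -rmulA vtxMid.
have [y <-] := line_point_left_inverse lu xu x0.
by apply: (Jl); exact: Jl.
Qed.

(** Local units put [a] into [L a], so this left ideal is nonzero and equals [M]. *)
Lemma minimal_left_ideal_gen M a x : minimal_left_ideal M -> M a -> a != 0 ->
  M x -> exists y, y ** a = x.
Proof.
move=> [[[M0 MD MN] Ml] _ Mmin] Ma a0 Mx.
have [y ya] := left_unit a.
suff ME : [set b ** a | b in setT] = M.
  by move: Mx; rewrite -{1}ME => -[b _ <-]; exists b.
apply: Mmin.
- by apply: left_ideal_mulr; split=> //; split.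
- by move=> _ [b _ <-]; exact: Ml.
move=> h; have : [set b ** a | b in setT] a by exists y.
by rewrite h /=; apply/eqP.
Qed.

(* The hypothesis says that the left ideal [L v] is minimal or zero. *)
Lemma minimal_vertex_line_point v :
  (forall b, b ** vtx v != 0 -> exists a, a ** (b ** vtx v) = vtx v) ->
  line_points E v.
Proof.
move=> hv.
(* The hypothesis passes along a path [q] from [v] to [w]: if [a b q^* = v], then
   [q^* a b w = q^* v q = w]. *)
have hT w b : reaches v w -> b ** vtx w != 0 -> exists a, a ** (b ** vtx w) = vtx w.
  move=> /reachesP[q vq] bw.
  have [|a ha] := hv (b ** gmon q w).
    rewrite -rmulA (gmon_vtx K vq); apply: contraNneq bw => bq.
    by rewrite -(gmonK K vq) rmulA bq rmul0r.
  exists (gmon q w ** a).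
  have := congr1 (fun x => gmon q w ** x ** mon q w) ha.
  rewrite (gmon_vtx K vq) (gmonK K vq) => h; rewrite -[RHS]h.
  by rewrite -!rmulA (vtx_mon K vq) (gmonK K vq).
have nb : no_bifurcation v.
  (* Some [a] satisfies [a e^* = w]; then [f = w f = a e^* f = 0], which is absurd. *)
  move=> w vw [e [f [ew fw ef]]].
  have ew' : gst e ** vtx w = gst e by rewrite -ew gst_src.
  have rn g : vtx (rge g) != 0 by exact: vtx_neq0.
  have [|a] := hT w (gst e) vw.
    by apply: contraNneq (rn e) => e0; rewrite -(gst_edgK K e) -ew' e0 rmul0r eqxx.
  rewrite ew' => ae; have := src_edg K f.
  rewrite fw -ae -rmulA gst_edg; case: eqP => // _; rewrite rmulr0 => f0.
  by move: (rn f); rewrite -(gst_edgK K f) -f0 rmulr0 eqxx.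
move=> w vw; split; first exact: nb.
move=> /cycle_walk[e [p wp]].
apply: (@closed_form_not_minimal K E w e p 1 [::] (vtx w)) => //.
- exact: no_bifurcation_reaches nb vw.
- exact: oner_neq0.
- by split=> //; rewrite /rcomb big_nil scale1r addr0.
by move=> b; exact: hT.
Qed.

Lemma minimal_left_ideal_sub M : minimal_left_ideal M ->
  M `<=` lpa_ideal K (line_points E).
Proof.
move=> Mmin; have [[[M0 MD MN] Ml] Mn _] := Mmin.
have [a Ma a0] := nonzero_mem M0 Mn.
have [l [r [w [k [s [k0 hx hs]]]]]] := reduction a0.
(* Recovering [l a] from [b l a] takes place in [M]; right multiplication by [r] carries it over to
   [l a r], which may lie outside [M]. *)
have hmin b : b ** (l ** a ** r) != 0 -> exists y, y ** (b ** (l ** a ** r)) = l ** a ** r.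
  move=> bx; have [|||y ybla] := @minimal_left_ideal_gen M (b ** (l ** a)) (l ** a) Mmin.
  - by exact/Ml/Ml.
  - by apply: contraNneq bx => bla; rewrite rmulA bla rmul0r.
  - exact: Ml.
  by exists y; rewrite [b ** _]rmulA rmulA ybla.
have s0 : s = [::].
  case: hs => // nb; case: s hx => // -[c [|e t]] s hx; first by case: hx.
  have /andP[wt _] := proj2 hx.
  by case: (closed_form_not_minimal nb wt k0 hx).
have xE : l ** a ** r = k *: vtx w.
  by case: hx => -> _; rewrite s0 /rcomb big_nil addr0.
have lw : line_points E w.
  apply: minimal_vertex_line_point => b bw.
  have [|y hy] := hmin b.
    by rewrite xE -rscaleAr scaler_eq0 (negPf k0).
  exists y; apply: (scalerI k0).
  by rewrite -[RHS]xE -hy xE -!rscaleAr.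
(* The factor [k^-1 w] gives [m r = w] and [w m = m]. From [m r m r = w], the element [r m] of [M]
   is nonzero, so it generates [M], and [r m = r w m] lies in the ideal of [w]. *)
pose m := (k^-1 *: vtx w) ** (l ** a).
have Mm : M m by exact/Ml/Ml.
have wm : vtx w ** m = m by rewrite /m rmulA -rscaleAr vtxMid.
have mr : m ** r = vtx w.
  by rewrite /m -rmulA xE -rscaleAr -rscaleAl vtxMid scalerA mulfV // scale1r.
have f0 : r ** m != 0.
  apply: contraNneq (vtx_neq0 K w) => rm0.
  by rewrite -vtxMid -{1}mr -mr -rmulA [r ** _]rmulA rm0 rmul0r rmulr0.
have [[I0 ID _] Il Ir] := two_sided_ideal_gen (vtx @` line_points E).
move=> x Mx; have [|//|y <-] := @minimal_left_ideal_gen M (r ** m) x Mmin _ f0.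
  exact: Ml.
rewrite -wm; apply: (Il); apply: (Il); apply: Ir.
by apply: sub_gen_smallest; exists w.
Qed.

End SocleLPA.

Theorem theorem5p2 (K : fieldType) (E : graph) :
  socle (LPA K E) = lpa_ideal K (line_points E) /\
  lpa_ideal K (line_points E) = lpa_ideal K (hs_closure (line_points E)).
Proof.
split; last exact: lpa_ideal_hs_closure.
apply/seteqP; split.
  apply: smallest_sub.
    by have [] := two_sided_ideal_gen (vtx K (E:=E) @` line_points E).
  by move=> x [M Mmin Mx]; exact: minimal_left_ideal_sub Mx.
apply: smallest_sub; first exact: socle_two_sided.
move=> _ [u lu <-]; apply: sub_gen_smallest.
exists [set a ** vtx K u | a in setT]; first exact: line_point_minimal.
by exists (vtx K u) => //; exact: vtxMid.
Qed.
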